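(* Let $0<p<2$, $q>0$, $M>0$, $\alpha>0$ with $s=\alpha+\frac12-\frac1p>0$, and let $\Theta=B^\alpha_{p,q}(M)$ or $\Theta=L_p(\alpha,M)$. In the Gaussian sequence model $Y_i=\theta_i+n^{-1/2}z_i$ ($z_i$ i.i.d. $N(0,1)$), the minimax risk for estimating $Q(\theta)=\sum_i\theta_i^2$ satisfies, as $n\to\infty$: (i) if $\alpha>\frac{1}{2p}$, then $\inf_\delta\sup_{\theta\in\Theta}E_\theta(\delta-Q(\theta))^2\ge\frac{4M^2}{n}(1+o(1))$; (ii) if $\alpha\le\frac{1}{2p}$, then there is a constant $C>0$ such that $\inf_\delta\sup_{\theta\in\Theta}E_\theta(\delta-Q(\theta))^2\ge C\,n^{-(2-p/(1+2ps))}$. Here the infimum is over all estimators $\delta$ (measurable functions of the observations).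
   Context: The $L_p$ ball is $L_p(\alpha,M)=\{\theta:(\sum_{i\ge1}i^{ps}|\theta_i|^p)^{1/p}\le M\}$ with $s=\alpha+\frac12-\frac1p$. For Besov balls, sequences are doubly indexed $\theta_{j,k}$, $j=0,1,\dots$, $k=0,\dots,2^j-1$, identified with $\theta_i$ via $i=2^j+k$, and $B^\alpha_{p,q}(M)=\{\theta:(\sum_{j\ge0}(2^{js}(\sum_{k=0}^{2^j-1}|\theta_{j,k}|^p)^{1/p})^q)^{1/q}\le M\}$. *)

(* Defs.v *)
From HB Require Import structures.
From mathcomp Require Import all_boot all_order all_algebra.
From mathcomp Require Import all_classical all_reals all_analysis.
Set Implicit Arguments. Unset Strict Implicit. Unset Printing Implicit Defensive.
Import Order.TTheory GRing.Theory Num.Theory.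
Local Open Scope classical_set_scope.
Local Open Scope ring_scope.

Section defs.
Context {R : realType}.

(* Convention: a sequence theta : nat -> R, where [theta i] is the paper's
   theta_{i+1} (the paper indexes from 1). *)

Definition Qf (th : nat -> R) : R := limn (fun m => \sum_(0 <= i < m) th i ^+ 2).

Definition sidx (p al : R) : R := al + 2^-1 - p^-1.

Definition Lp_ball (p al M : R) : set (nat -> R) :=
  [set th | (poweR (\sum_(0 <= i <oo)
       (((i.+1)%:R `^ (p * sidx p al) * `|th i| `^ p)%:E)) p^-1 <= M%:E)%E].

(* level-j l_p norm: (sum_{k=0}^{2^j-1} |theta_{j,k}|^p)^{1/p},
   theta_{j,k} = theta_{2^j+k} (paper indexing) = th (2^j + k - 1) *)
Definition besov_level (p : R) (th : nat -> R) (j : nat) : R :=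
  (\sum_(k < 2 ^ j) `|th (2 ^ j + k).-1| `^ p) `^ p^-1.

Definition Besov_ball (p q al M : R) : set (nat -> R) :=
  [set th | (poweR (\sum_(0 <= j <oo)
       (((2%:R `^ (j%:R * sidx p al) * besov_level p th j) `^ q)%:E)) q^-1
       <= M%:E)%E].

Definition coord_sets : set (set (nat -> R)) :=
  [set A | exists i (B : set R), measurable B /\ A = (fun x => x i) @^-1` B].

Definition is_estimator : set ((nat -> R) -> R) :=
  [set dl | forall B : set R, measurable B -> <<s coord_sets >> (dl @^-1` B)].

Context {d : measure_display} {Omega : measurableType d}.

Definition iid_std_normal (P : probability Omega R) (z : nat -> Omega -> R) :=
  [/\ (forall i, measurable_fun setT (z i)),
      (forall i (B : set R), measurable B ->
          P (z i @^-1` B) = normal_prob 0 1 B) &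
      (forall (s : seq nat) (B : nat -> set R), uniq s ->
          (forall i, measurable (B i)) ->
          P (\bigcap_(i in [set i | i \in s]) (z i @^-1` B i)) =
          (\prod_(i <- s) P (z i @^-1` B i))%E)].

Definition obs (n : nat) (th : nat -> R) (z : nat -> Omega -> R) :
  Omega -> nat -> R := fun w i => th i + (Num.sqrt n%:R)^-1 * z i w.

Definition risk (P : probability Omega R) (z : nat -> Omega -> R) (n : nat)
  (dl : (nat -> R) -> R) (th : nat -> R) : \bar R :=
  (\int[P]_w (((dl (obs n th z w) - Qf th) ^+ 2)%:E))%E.

Definition minimax_risk (P : probability Omega R) (z : nat -> Omega -> R)
  (n : nat) (Theta : set (nat -> R)) : \bar R :=
  ereal_inf [set ereal_sup [set risk P z n dl th | th in Theta]
            | dl in is_estimator].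

End defs.

(* Main.v *)
Require Import Defs.
From HB Require Import structures.
From mathcomp Require Import all_boot all_order all_algebra.
From mathcomp Require Import all_classical all_reals all_analysis.
From mathcomp Require Import measurable_realfun.
From mathcomp Require Import ring lra.
Set Implicit Arguments. Unset Strict Implicit. Unset Printing Implicit Defensive.
Import Order.TTheory GRing.Theory Num.Theory.
Import numFieldNormedType.Exports.
Local Open Scope classical_set_scope.
Local Open Scope ring_scope.

(** Both bounds are Bayes bounds for a finite prior on finitely supported
    signals, and neither uses the comparison between [al] and [1/(2p)].
    After rescaling the noise to unit variance, the law of [z + th] has density
    [tiltn m th] with respect to the law of [z] (Gaussian shift), so the Bayes
    risk is the integral of a pointwise expression in which the estimator is a
    free real number [x]; bounding that expression below, uniformly in [x], by
    a combination of densities leaves only explicit Gaussian integrals.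

    (i) The prior is uniform on a grid of [K + 2] values of the first
    coordinate ending at [M], with step [sqrt (del / n)]; the pointwise bound
    is a discrete van Trees inequality.  Letting [n] go to infinity, then [K],
    then [del] to [0] gives [4 M^2 / n].

    (ii) With [k = 2^m], cut the Besov level [2m] into [k] blocks of length [k]
    and put one spike of height [c / sqrt n] at a uniform position in each
    block.  The second moment of the likelihood ratio of this mixture against
    [th = 0] is [(1 + (exp (c^2) - 1) / k)^k <= exp (exp (c^2) - 1)], while [Q]
    moves by [k c^2 / n].  The ball allows [k] of order
    [n^(p / (2 (1 + 2ps)))]. *)

(** * Gaussian shift *)

(* Real sequences with the sigma-algebra generated by the coordinates. *)
Notation seqR R := (g_sigma_algebraType (@coord_sets R)).

Section std_normal.
Context {R : realType}.
Local Notation mu := (@lebesgue_measure R).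
Local Notation gauss := (@normal_prob R 0 1).
Local Open Scope ereal_scope.

(** The Radon-Nikodym derivative of the normal law and [normal_pdf] have the same integral over
    every measurable set, hence agree almost everywhere. *)
Lemma ge0_integral_normal_prob (m s : R) (f : R -> \bar R) :
  measurable_fun setT f -> (forall x, 0 <= f x) ->
  \int[normal_prob m s]_x f x = \int[mu]_x (f x * (normal_pdf m s x)%:E).
Proof.
move=> mf f0.
have dom := normal_prob_dominates m s.
rewrite -(Radon_Nikodym_SigmaFinite.change_of_variables dom)//.
have iRN := Radon_Nikodym_SigmaFinite.f_integrable dom.
apply: ae_eq_integral => //.
- apply: emeasurable_funM => //; exact: (measurable_int mu).
- apply: emeasurable_funM => //; apply/measurable_EFinP.
  exact: measurable_normal_pdf.
- apply: ae_eqe_mul2l; apply: integral_ae_eq => //.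
  + by apply/measurable_EFinP; exact: measurable_normal_pdf.
  + by move=> E _ mE; rewrite -Radon_Nikodym_SigmaFinite.f_integral.
Qed.

(** The image of Lebesgue measure under a translation gives half-open intervals their length, and
    this determines the measure. *)
Lemma lebesgue_measureD (t : R) (A : set R) : measurable A ->
  mu [set x | A (x + t)%R] = mu A.
Proof.
have mt : measurable_fun setT (fun x : measurableTypeR R => (x + t)%R : measurableTypeR R).
  by apply: measurable_funD => //; exact: measurable_cst.
move=> mA; apply/esym.
rewrite -[RHS]/(pushforward mu (fun x : measurableTypeR R => (x + t)%R : measurableTypeR R) A).
apply: lebesgue_measure_unique => //= _ [[a b]] _ <-.
rewrite /pushforward/=.
have -> : (fun x => (x + t)%R) @^-1` `]a, b] = `](a - t)%R, (b - t)%R]%classic.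
  by apply/seteqP; split => x /=; rewrite !in_itv/= ltrBlDr lerBrDr.
rewrite !lebesgue_measure_itv/= !lte_fin ltrD2r -!EFinB.
by congr (if _ then _%:E else _); ring.
Qed.

Lemma ge0_integral_lebesgueD (t : R) (f : R -> \bar R) :
  measurable_fun setT f -> (forall x, 0 <= f x) ->
  \int[mu]_x f (x + t)%R = \int[mu]_x f x.
Proof.
move=> mf f0.
have mt : measurable_fun setT (fun x : measurableTypeR R => (x + t)%R : measurableTypeR R).
  by apply: measurable_funD => //; exact: measurable_cst.
transitivity (\int[pushforward mu
  (fun x : measurableTypeR R => (x + t)%R : measurableTypeR R)]_x f x).
  by rewrite ge0_integral_pushforward.
by apply: eq_measure_integral => // A mA _; exact: lebesgue_measureD.
Qed.

(** The likelihood ratio of N(t, 1) against N(0, 1) at [x]. *)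
Definition tilt (t x : R) : R := expR (t * x - t ^+ 2 / 2).

Lemma measurable_tilt t : measurable_fun setT (tilt t).
Proof.
by apply: measurableT_comp => //; apply: measurable_funB => //; exact: measurable_funM.
Qed.

(** Translating the right-hand Lebesgue integral by [t] reduces this to an identity of integrands:
    [tilt t (x + t)] times the density at [x + t] is the density at [x]. *)
Lemma gauss_shift (t : R) (f : R -> \bar R) :
  measurable_fun setT f -> (forall x, 0 <= f x) ->
  \int[gauss]_x f (x + t)%R = \int[gauss]_x (f x * (tilt t x)%:E).
Proof.
move=> mf f0.
have mpdf : measurable_fun setT (EFin \o normal_pdf (0 : R) 1).
  by apply/measurable_EFinP; exact: measurable_normal_pdf.
have mtilt : measurable_fun setT (EFin \o tilt t).
  by apply/measurable_EFinP; exact: measurable_tilt.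
have tilt0 x : 0 <= (tilt t x)%:E by rewrite lee_fin expR_ge0.
have pdf0 x : 0 <= (normal_pdf (0 : R) 1 x)%:E by rewrite lee_fin normal_pdf_ge0.
rewrite !ge0_integral_normal_prob //.
- rewrite -[RHS](ge0_integral_lebesgueD t).
  + apply: eq_integral => x _; rewrite -muleA -EFinM; congr (_ * _%:E).
    rewrite !normal_pdfE ?oner_eq0// mulrCA; congr (_ * _)%R.
    rewrite /normal_fun /tilt -expRD; congr expR; by field.
  + by apply: emeasurable_funM => //; exact: emeasurable_funM.
  + by move=> x; rewrite !mule_ge0.
- exact: emeasurable_funM.
- by move=> x; rewrite mule_ge0.
- apply: measurableT_comp => //; exact: measurable_funD.
Qed.

End std_normal.

(** * The product sigma-algebra on real sequences *)

Section seq_measurable.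
Context {R : realType}.

Definition upd (i : nat) (u : R) (x : nat -> R) : nat -> R :=
  fun j => if j == i then u else x j.

Definition box (B : nat -> set R) : set (nat -> R) :=
  [set x | forall j, B j (x j)].

(** Only the coordinates below [m] are constrained, so independence evaluates the noise law on a box
    as a finite product. These boxes form the pi-system used to identify laws on sequences. *)
Definition boxes : set (set (nat -> R)) :=
  [set A | exists m B, [/\ forall j, measurable (B j),
     forall j, (m <= j)%N -> B j = setT & A = box B]].

Lemma measurable_coord i : measurable_fun setT (fun x : seqR R => x i).
Proof.
move=> _ B mB; rewrite setTI; apply: sub_sigma_algebra.
by exists i, B.
Qed.

Lemma measurable_seq_fun d (T : measurableType d) (f : T -> seqR R) :
  (forall i, measurable_fun setT (fun w => f w i)) -> measurable_fun setT f.
Proof.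
move=> mf; apply: (@measurability _ _ T (seqR R) setT f (@coord_sets R)) => //.
by move=> _ [_ [i [B [mB ->]]] <-]; exact: mf.
Qed.

Lemma measurable_box (B : nat -> set R) : (forall j, measurable (B j)) ->
  @measurable _ (seqR R) (box B).
Proof.
move=> mB.
have -> : box B = \bigcap_j ((fun x : nat -> R => x j) @^-1` B j).
  by apply/seteqP; split => x /= h j => [_|]; exact: h.
apply: bigcapT_measurable => j; apply: sub_sigma_algebra; by exists j, (B j).
Qed.

Lemma measurable_seqE : @measurable _ (seqR R) = <<s boxes >>.
Proof.
apply/seteqP; split.
- apply: smallest_sub; first exact: smallest_sigma_algebra.
  move=> _ [i [B [mB ->]]]; apply: sub_sigma_algebra.
  exists i.+1, (fun j => if j == i then B else setT); split.
  + by move=> j; case: ifP.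
  + by move=> j ij; rewrite gtn_eqF.
  + apply/seteqP; split => x /=; last by move/(_ i); rewrite eqxx.
    by move=> Bx j; case: eqP => // ->.
- apply: smallest_sub; first exact: sigma_algebra_measurable.
  by move=> _ [m [B [mB _ ->]]]; exact: measurable_box.
Qed.

Lemma boxes_setI : setI_closed boxes.
Proof.
move=> _ _ [m [B [mB BT ->]]] [m' [B' [mB' BT' ->]]].
exists (maxn m m'), (fun j => B j `&` B' j); split.
- by move=> j; exact: measurableI.
- by move=> j; rewrite geq_max => /andP[? ?]; rewrite BT// BT'// setIT.
- by apply/seteqP; split => x /= => [[h h'] j|h]; split=> // j; have [] := h j.
Qed.

Lemma measurable_upd d (T : measurableType d) i (u : T -> R) (x : T -> seqR R) :
  measurable_fun setT u -> measurable_fun setT x ->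
  measurable_fun setT (fun w => upd i (u w) (x w) : seqR R).
Proof.
move=> mu mx; apply: measurable_seq_fun => j; rewrite /upd.
by case: eqP => // _; apply: (measurableT_comp (measurable_coord j)).
Qed.

End seq_measurable.

(** * The law of the noise sequence *)

Section iid.
Context {R : realType} {d : measure_display} {Omega : measurableType d}.
Variables (P : probability Omega R) (z : nat -> Omega -> R).
Hypothesis iidz : iid_std_normal P z.
Local Notation gauss := (@normal_prob R 0 1).
Local Notation Z := (fun w => z ^~ w : seqR R).
Local Open Scope ereal_scope.

Let mz i : measurable_fun setT (z i). Proof. by case: iidz. Qed.

Lemma measurable_noise : measurable_fun setT Z.
Proof. exact: measurable_seq_fun. Qed.

Lemma noise_box m (B : nat -> set R) : (forall j, measurable (B j)) ->
  (forall j, (m <= j)%N -> B j = setT) ->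
  P (Z @^-1` box B) = \prod_(j < m) gauss (B j).
Proof.
move=> mB BT; case: iidz => _ zlaw zind.
have -> : Z @^-1` box B = \bigcap_(i in [set i | i \in iota 0 m]) (z i @^-1` B i).
  apply/seteqP; split => w /= h i; first by move=> _; exact: h.
  have [im|mi] := ltnP i m; last by rewrite BT.
  by apply: h => /=; rewrite mem_iota.
rewrite zind ?iota_uniq// -(big_mkord xpredT (fun j => gauss (B j))) /index_iota subn0.
by apply: eq_bigr => j _; rewrite zlaw.
Qed.

(** Coordinate [i] is independent of the others, so a fresh Gaussian in its place leaves the law
    unchanged: both laws agree on boxes, hence everywhere. This brings one-dimensional integrals
    into the sequence model. *)
Lemma noise_resample i (F : seqR R -> \bar R) :
  measurable_fun setT F -> (forall x, 0 <= F x) ->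
  \int[P]_w F (Z w) = \int[P]_w \int[gauss]_u F (upd i u (Z w)).
Proof.
move=> mF F0.
pose Phi (wu : Omega * measurableTypeR R) : seqR R := upd i wu.2 (Z wu.1).
have mPhi : measurable_fun setT Phi.
  apply: (@measurable_upd R _ (Omega * measurableTypeR R)%type i snd (Z \o fst)).
    exact: measurable_snd.
  exact: measurableT_comp measurable_noise measurable_fst.
have mFPhi : measurable_fun setT (F \o Phi) by exact: measurableT_comp.
transitivity (\int[P \x gauss]_wu F (Phi wu)); last first.
  by rewrite (fubini_tonelli1 (F \o Phi))// => ?; exact: F0.
transitivity (\int[pushforward P Z]_x F x).
  by rewrite ge0_integral_pushforward//; exact: measurable_noise.
transitivity (\int[pushforward (P \x gauss) Phi]_x F x); last first.
  by rewrite ge0_integral_pushforward.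
have mZ := measurable_noise.
apply: eq_measure_integral => // A mA _.
apply: (@measure_unique _ R (seqR R) (@boxes R) (fun=> setT)) => //.
- exact: measurable_seqE.
- exact: boxes_setI.
- by move=> _; exists 0%N, (fun=> setT); split=> //; apply/seteqP; split.
- by rewrite bigcup_const.
- move=> _ [m [B [mB BT ->]]].
  rewrite -[LHS]/(P (Z @^-1` box B)) -[RHS]/((P \x gauss) (Phi @^-1` box B)).
  (* The constraint at [i] falls on the fresh variable alone; [B'] keeps the constraints on the old
     noise. *)
  pose B' j := if j == i then setT else B j.
  have -> : Phi @^-1` box B = (Z @^-1` box B') `*` B i.
    apply/seteqP; split => [[w u]|[w u] [/= h hu] j] /=; rewrite /Phi /upd /=.
    + move=> h; split; last by have := h i; rewrite eqxx.
      by move=> j; rewrite /B'; have := h j; case: eqP.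
    + by have := h j; rewrite /B'; case: eqP => [->|].
  have mB' j : measurable (B' j) by rewrite /B'; case: ifP.
  (* The bound is raised past [i] so that the finite product contains the factor at [i]. *)
  have Bm j : (maxn m i.+1 <= j)%N -> B j = setT.
    by rewrite geq_max => /andP[mj _]; exact: BT.
  have B'm j : (maxn m i.+1 <= j)%N -> B' j = setT.
    by move=> /Bm; rewrite /B'; case: ifP.
  have mZB' : measurable (Z @^-1` box B').
    by have := measurable_noise measurableT (measurable_box mB'); rewrite setTI.
  transitivity (P (Z @^-1` box B') * gauss (B i)); last first.
    by have := @product_measure1E _ _ _ _ R P gauss _ _ mZB' (mB i); move=> ->.
  rewrite (noise_box mB Bm) (noise_box mB' B'm).
  have im : (i < maxn m i.+1)%N by rewrite leq_max leqnn orbT.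
  rewrite (bigD1 (Ordinal im))//= [in RHS](bigD1 (Ordinal im))//=.
  have -> : B' i = setT by rewrite /B' eqxx.
  rewrite probability_setT mul1e muleC; congr (_ * _).
  by apply: eq_bigr => j; rewrite /B' -val_eqE/= => /negbTE->.
- by move=> _; rewrite -[X in X < _]/(P setT) probability_setT ltry.
Qed.
End iid.

(** * Algebra of likelihood ratios *)

Section tilting.
Context {R : realType}.

Definition tiltn (m : nat) (th y : nat -> R) : R := \prod_(i < m) tilt (th i) (y i).

Lemma tiltn_gt0 m th y : 0 < tiltn m th y.
Proof. by apply: prodr_gt0 => i _; exact: expR_gt0. Qed.

Lemma measurable_tiltn m th :
  measurable_fun setT (tiltn m th : seqR R -> R).
Proof.
apply: (@measurable_prod _ (seqR R) R setT 'I_m (index_enum 'I_m)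
  (fun i (y : seqR R) => tilt (th i) (y i))) => i _.
exact: (measurableT_comp (measurable_tilt (th i)) (measurable_coord i)).
Qed.

(** Exponents are linear in [y] and quadratic in the shift, so multiplying two tilts adds the shifts
    and leaves the cross term of the square. *)
Lemma tiltnM m (a b y : nat -> R) :
  tiltn m a y * tiltn m b y =
  expR (\sum_(i < m) a i * b i) * tiltn m (fun i => a i + b i) y.
Proof.
rewrite expR_sum /tiltn -!big_split/=; apply: eq_bigr => i _.
by rewrite /tilt -!expRD; congr expR; field.
Qed.

Lemma tiltnV m (a y : nat -> R) :
  (tiltn m a y)^-1 = expR (\sum_(i < m) a i ^+ 2) * tiltn m (fun i => - a i) y.
Proof.
apply: (mulfI (lt0r_neq0 (tiltn_gt0 m a y))); rewrite divff ?gt_eqF ?tiltn_gt0//.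
rewrite mulrCA tiltnM mulrA -expRD -big_split/= big1 => [|i _]; last by rewrite mulrN expr2 subrr.
rewrite expR0 mul1r /tiltn big1// => i _.
by rewrite /tilt subrr mul0r expr0n/= mul0r subrr expR0.
Qed.

End tilting.

(** * Shifting finitely many noise coordinates *)

Section noise_shift.
Context {R : realType} {d : measure_display} {Omega : measurableType d}.
Variables (P : probability Omega R) (z : nat -> Omega -> R).
Hypothesis iidz : iid_std_normal P z.
Local Notation gauss := (@normal_prob R 0 1).
Local Notation Z := (fun w => z ^~ w : seqR R).
Local Open Scope ereal_scope.

(** After resampling coordinate [i] on both sides, the other coordinates are frozen and
    [gauss_shift] applies to the inner integral. *)
Lemma noise_shift1 i (t : R) (F : seqR R -> \bar R) :
  measurable_fun setT F -> (forall x, 0 <= F x) ->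
  \int[P]_w F (upd i (z i w + t)%R (Z w)) =
  \int[P]_w (F (Z w) * (tilt t (z i w))%:E).
Proof.
move=> mF F0.
have mi := measurable_coord (R := R) i.
pose H (x : seqR R) := F (upd i (x i + t)%R x).
have mH : measurable_fun setT H.
  apply: (measurableT_comp mF).
  by apply: (@measurable_upd R _ (seqR R) i (fun x => x i + t)%R id) => //; exact: measurable_funD.
pose K (x : seqR R) := F x * (tilt t (x i))%:E.
have mK : measurable_fun setT K.
  apply: emeasurable_funM => //; apply/measurable_EFinP.
  exact: (measurableT_comp (measurable_tilt t)).
have tilt0 x : 0 <= (tilt t x)%:E by rewrite lee_fin expR_ge0.
rewrite (noise_resample iidz i mH) => [|x]; last exact: F0.
rewrite (noise_resample iidz i mK) => [|x]; last by rewrite mule_ge0.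
apply: eq_integral => w _.
pose f (u : R) := F (upd i u (Z w)).
have mf : measurable_fun setT f.
  apply: (measurableT_comp mF).
  by apply: (@measurable_upd R _ R i id (cst (Z w))) => //; exact: measurable_cst.
have e u : upd i (upd i u (Z w) i + t)%R (upd i u (Z w)) = upd i (u + t)%R (Z w).
  by apply/funext => j; rewrite /upd eqxx; case: eqP.
transitivity (\int[gauss]_u f (u + t)%R).
  by apply: eq_integral => u _; rewrite /H e.
rewrite (gauss_shift t mf (fun u => F0 _)).
by apply: eq_integral => u _; rewrite /K /f /= /upd eqxx.
Qed.

Lemma noise_shift m (th : nat -> R) (F : seqR R -> \bar R) :
  (forall j, (m <= j)%N -> th j = 0%R) ->
  measurable_fun setT F -> (forall x, 0 <= F x) ->
  \int[P]_w F (fun j => z j w + th j)%R =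
  \int[P]_w (F (Z w) * (tiltn m th (Z w))%:E).
Proof.
elim: m th F => [|m IH] th F thm mF F0.
  apply: eq_integral => w _; rewrite /tiltn big_ord0 mule1; congr F.
  by apply/funext => j; rewrite thm// addr0.
(* Induction peels off the last coordinate: its shift moves from [th] into the function [F']. As
   [tiltn m] does not read coordinate [m], [noise_shift1] then supplies the missing factor. *)
pose th' j := if j == m then 0%R else th j.
have th'm j : (m <= j)%N -> th' j = 0%R.
  by rewrite /th' leq_eqVlt; case: eqVneq => //= ? mj; exact: thm.
pose F' (x : seqR R) := F (upd m (x m + th m)%R x).
have mF' : measurable_fun setT F'.
  apply: (measurableT_comp mF).
  apply: (@measurable_upd R _ (seqR R) m (fun x => x m + th m)%R id) => //.
    by apply: measurable_funD => //; exact: measurable_coord.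
have := IH th' F' th'm mF' (fun x => F0 _).
rewrite (_ : (fun w => F' _) = (fun w => F (fun j => z j w + th j)%R)); last first.
  apply/funext => w; rewrite /F'; congr F; apply/funext => j.
  by rewrite /upd /th'; case: eqP => [->|//]; rewrite eqxx addr0.
move=> ->.
have tt' (x : nat -> R) : tiltn m th' x = tiltn m th x.
  by apply: eq_bigr => i _; rewrite /th' ltn_eqF.
pose G (x : seqR R) := F x * (tiltn m th x)%:E.
have mG : measurable_fun setT G.
  by apply: emeasurable_funM => //; apply/measurable_EFinP; exact: measurable_tiltn.
have G0 x : 0 <= G x by rewrite mule_ge0// lee_fin ltW// tiltn_gt0.
transitivity (\int[P]_w G (upd m (z m w + th m)%R (Z w))).
  apply: eq_integral => w _; rewrite tt' /G /F'; congr (_ * _%:E).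
  by apply: eq_bigr => i _; rewrite /upd ltn_eqF.
rewrite noise_shift1//; apply: eq_integral => w _.
by rewrite /G -muleA -EFinM /tiltn big_ord_recr.
Qed.

(** Integrability is bundled with the value so that signed combinations of likelihood ratios can be
    integrated term by term. *)
Definition has_mean (H : (nat -> R) -> R) (c : R) :=
  P.-integrable setT (fun w => (H (Z w))%:E) /\ \int[P]_w (H (Z w))%:E = c%:E.

Lemma has_meanD (H1 H2 : (nat -> R) -> R) c1 c2 : has_mean H1 c1 -> has_mean H2 c2 ->
  has_mean (fun y => H1 y + H2 y)%R (c1 + c2)%R.
Proof.
move=> [i1 e1] [i2 e2]; split.
  have := integrableD measurableT i1 i2.
  by apply: eq_integrable => // w _; rewrite EFinD.
under eq_integral do rewrite EFinD.
by rewrite integralD// e1 e2.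
Qed.

Lemma has_meanZ (k : R) (H : (nat -> R) -> R) c : has_mean H c ->
  has_mean (fun y => k * H y)%R (k * c)%R.
Proof.
move=> [i1 e1]; split.
  have := integrableZl measurableT k i1.
  by apply: eq_integrable => // w _; rewrite EFinM.
under eq_integral do rewrite EFinM.
by rewrite integralZl// e1.
Qed.

Lemma has_mean_sum (I : Type) (s : seq I) (H : I -> (nat -> R) -> R) c :
  (forall i, has_mean (H i) (c i)) ->
  has_mean (fun y => \sum_(i <- s) H i y)%R (\sum_(i <- s) c i)%R.
Proof.
move=> h; elim: s => [|i s IH].
  split.
    rewrite (_ : (fun w => _) = cst 0); last by apply/funext => w; rewrite big_nil.
    exact: integrable0.
  by rewrite big_nil; apply: integral0_eq => w _; rewrite big_nil.
rewrite big_cons; have := has_meanD (h i) IH.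
by congr (has_mean _ _); apply/funext => y; rewrite big_cons.
Qed.

Lemma has_mean_tiltn m th : has_mean (tiltn m th) 1.
Proof.
have int1 : \int[P]_w (tiltn m th (Z w))%:E = 1%:E.
  (* [noise_shift] asks for a finitely supported shift; truncating [th] at [m] does not change
     [tiltn m]. *)
  pose th' j := if (j < m)%N then th j else 0%R.
  have th'm j : (m <= j)%N -> th' j = 0%R by rewrite /th' ltnNge => ->.
  have := noise_shift th'm (measurable_cst (1 : \bar R)) (fun=> lee01).
  rewrite integral_cst//; set p := (X in _ * X); have -> : p = 1 by exact: probability_setT.
  rewrite mule1 => ->.
  apply: eq_integral => w _; rewrite mul1e; congr _%:E.
  by apply: eq_bigr => i _; rewrite /th' ltn_ord.
split=> //; apply/integrableP; split.
  apply/measurable_EFinP; apply: (measurableT_comp (measurable_tiltn m th)).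
  exact: measurable_noise iidz.
under eq_integral => w _ do rewrite gee0_abs ?lee_fin ?ltW ?tiltn_gt0//.
by rewrite int1 ltry.
Qed.

End noise_shift.

(** * Bayes lower bound *)

Section bayes.
Context {R : realType} {d : measure_display} {Omega : measurableType d}.
Variables (P : probability Omega R) (z : nat -> Omega -> R).
Hypothesis iidz : iid_std_normal P z.
Local Notation Z := (fun w => z ^~ w : seqR R).

Lemma measurable_noise_comp (g : seqR R -> R) :
  measurable_fun setT g -> measurable_fun setT (fun w => (g (Z w))%:E).
Proof.
move=> mg; apply/measurable_EFinP; apply: (measurableT_comp mg).
exact: measurable_noise iidz.
Qed.

(** The observation is the shifted unit noise [z + sqrt n * th] divided by [sqrt n], so
    [noise_shift] moves the signal out of the argument of [dl] into the density. *)
Lemma risk_tilt n m (dl : (nat -> R) -> R) (th : nat -> R) :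
  (0 < n)%N -> is_estimator dl -> (forall i, (m <= i)%N -> th i = 0) ->
  risk P z n dl th =
  (\int[P]_w ((dl (fun j => (Num.sqrt n%:R)^-1 * z j w) - Qf th) ^+ 2 *
     tiltn m (fun i => Num.sqrt n%:R * th i) (Z w))%:E)%E.
Proof.
move=> n0 edl thm; set s := Num.sqrt n%:R.
have s0 : s != 0 by rewrite gt_eqF// sqrtr_gt0 ltr0n.
pose F (x : seqR R) := ((dl (fun j => s^-1 * x j) - Qf th) ^+ 2)%:E.
have mdl : measurable_fun setT (dl : seqR R -> R).
  by move=> _ B mB; rewrite setTI; exact: edl.
have mscale : measurable_fun setT (fun x : seqR R => (fun j => s^-1 * x j) : seqR R).
  apply: measurable_seq_fun => j; apply: measurable_funM => //; exact: measurable_coord.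
have mF : measurable_fun setT F.
  apply/measurable_EFinP; apply: measurable_funX; apply: measurable_funB => //.
  exact: (measurableT_comp mdl mscale).
have F0 x : (0 <= F x)%E by rewrite lee_fin sqr_ge0.
have thm' j : (m <= j)%N -> s * th j = 0 by move=> /thm ->; rewrite mulr0.
transitivity (\int[P]_w F (fun j => z j w + s * th j)%R)%E.
  apply: eq_integral => w _; rewrite /F; congr ((dl _ - _) ^+ 2)%:E.
  by apply/funext => j; rewrite /obs mulrDr mulKf// addrC.
by rewrite (noise_shift iidz thm' mF F0).
Qed.

(* Only [H] is integrated as a signed function: [dl] need not be
   integrable. *)
Lemma bayes_lower_bound n m (dl : (nat -> R) -> R) (I : finType) (pi : I -> R)
    (th : I -> nat -> R) (S : \bar R) (H : (nat -> R) -> R) (c : R) :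
  (0 < n)%N -> is_estimator dl ->
  (forall i, 0 <= pi i) -> \sum_i pi i = 1 ->
  (forall i j, (m <= j)%N -> th i j = 0) ->
  (forall i, (risk P z n dl (th i) <= S)%E) ->
  has_mean P z H c ->
  (forall y x, H y <= \sum_i pi i *
     ((x - Qf (th i)) ^+ 2 * tiltn m (fun j => Num.sqrt n%:R * th i j) y)) ->
  (c%:E <= S)%E.
Proof.
move=> n0 edl pi0 pi1 thm riskS [intH <-] HG.
have mdl : measurable_fun setT (dl : seqR R -> R).
  by move=> _ B mB; rewrite setTI; exact: edl.
set s := Num.sqrt n%:R in HG *.
pose L i (y : nat -> R) := (dl (fun j => s^-1 * y j) - Qf (th i)) ^+ 2 *
   tiltn m (fun j => s * th i j) y.
have L0 i y : 0 <= L i y by rewrite mulr_ge0 ?sqr_ge0// ltW// tiltn_gt0.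
have mscale : measurable_fun setT (fun x : seqR R => (fun j => s^-1 * x j) : seqR R).
  by apply: measurable_seq_fun => j; apply: measurable_funM => //; exact: measurable_coord.
have mL i : measurable_fun setT (L i : seqR R -> R).
  apply: measurable_funM; last exact: measurable_tiltn.
  apply: measurable_funX; apply: measurable_funB => //.
  exact: (measurableT_comp mdl mscale).
pose G (w : Omega) := (\sum_i (pi i)%:E * (L i (Z w))%:E)%E.
have mG : measurable_fun setT G.
  apply: emeasurable_sum => i; apply: emeasurable_funM => //.
  exact: measurable_noise_comp.
have G0 w : (0 <= G w)%E.
  by apply: sume_ge0 => i _; rewrite mule_ge0 ?lee_fin.
have GS : (\int[P]_w G w <= S)%E.
  rewrite ge0_integral_sum//; last 2 first.
  - by move=> i; apply: emeasurable_funM => //; exact: measurable_noise_comp.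
  - by move=> i w _; rewrite mule_ge0 ?lee_fin.
  (* The worst risk dominates the prior average. *)
  have -> : S = (\sum_i (pi i)%:E * S)%E.
    by rewrite -ge0_sume_distrl ?sumEFin ?pi1 ?mul1e// => i _; rewrite lee_fin.
  apply: lee_sum => i _; rewrite ge0_integralZl_EFin//.
  - by rewrite lee_wpmul2l ?lee_fin// -(risk_tilt n0 edl (thm i)).
  - by move=> w _; rewrite lee_fin.
  - exact: measurable_noise_comp.
apply: le_trans GS.
have HGw w : ((H (Z w))%:E <= G w)%E.
  rewrite /G; under eq_bigr do rewrite -EFinM.
  by rewrite sumEFin lee_fin; exact: HG.
(* [H] is signed, so its comparison with [G] needs [G] integrable; an infinite integral of [G] makes
   the claim trivial. *)
have [->|Goo] := eqVneq (\int[P]_w G w)%E +oo%E; first exact: leey.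
apply: le_integral => //.
apply/integrableP; split => //.
under eq_integral do rewrite gee0_abs//.
by rewrite ltey.
Qed.

End bayes.

(** * The parametric bound *)

Section finite_support.
Context {R : realType}.

Lemma Qf_finite m (th : nat -> R) : (forall i, (m <= i)%N -> th i = 0) ->
  Qf th = \sum_(i < m) th i ^+ 2.
Proof.
move=> thm; rewrite /Qf -(big_mkord xpredT (fun i => th i ^+ 2)).
apply: lim_near_cst => //.
near=> k.
have mk : (m <= k)%N by near: k; exact: nbhs_infty_ge.
rewrite (big_cat_nat (leq0n m) mk)//= -[RHS]addr0; congr (_ + _).
rewrite big_nat_cond big1// => i /andP[/andP[mi _] _].
by rewrite thm// expr0n.
Unshelve. all: by end_near. Qed.

End finite_support.

Section van_trees.
Context {R : realType}.

(* Summation by parts turns the telescoping score [p j - p j.-1] into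
   increments of [g]; the square is completed at every [j]. *)
Lemma discrete_van_trees K (p g : nat -> R) (lam x : R) : (forall j, 0 < p j) ->
  2 * lam * (\sum_(j < K.+1) (g j.+1 - g j) * p j) -
  lam ^+ 2 * (\sum_(j < K.+1) p j - 2 * (\sum_(j < K) p j)
              + \sum_(j < K.+1) p j ^+ 2 / p j.+1)
  <= \sum_(j < K.+2) p j * (x - g j) ^+ 2.
Proof.
move=> p0.
have sq j b : 0 <= p j * (x - g j - lam * b / p j) ^+ 2.
  by rewrite mulr_ge0 ?sqr_ge0 ?ltW.
have sqE j b : p j * (x - g j - lam * b / p j) ^+ 2 =
    p j * (x - g j) ^+ 2 - 2 * lam * (x - g j) * b + lam ^+ 2 * (b ^+ 2 / p j).
  by have := p0 j; move=> /lt0r_neq0 ?; field.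
(* The sum stopped before the last index leaves the boundary term [(x - g K.+1) * p K], which the
   final square, with score [- p K], cancels. *)
have partial : 2 * lam * (\sum_(j < K.+1) (g j.+1 - g j) * p j + (x - g K.+1) * p K) -
    lam ^+ 2 * (\sum_(j < K.+1) p j - 2 * (\sum_(j < K) p j)
              + \sum_(j < K) p j ^+ 2 / p j.+1)
  <= \sum_(j < K.+1) p j * (x - g j) ^+ 2.
  elim: K => [|K IH].
    rewrite !big_ord_recr !big_ord0/= !add0r.
    have := sq 0%N (p 0%N); rewrite sqE.
    have -> : p 0%N ^+ 2 / p 0%N = p 0%N by rewrite expr2 mulfK// gt_eqF.
    lra.
  have := sq K.+1 (p K.+1 - p K); rewrite sqE.
  have -> : (p K.+1 - p K) ^+ 2 / p K.+1 = p K.+1 - 2 * p K + p K ^+ 2 / p K.+1.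
    by have := p0 K.+1; move=> /lt0r_neq0 ?; field.
  rewrite [in X in _ -> X]big_ord_recr/= [in X in _ -> _ <= X]big_ord_recr/=.
  rewrite [\sum_(j < K.+2) p j]big_ord_recr/=.
  rewrite [in X in _ -> X](big_ord_recr K (fun j => p j ^+ 2 / p j.+1))/=.
  move: IH; rewrite !(big_ord_recr K p)/=.
  set A := \sum_(j < K.+1) (g j.+1 - g j) * p j.
  set B := \sum_(i < K) p i.
  set D := \sum_(j < K) p j ^+ 2 / p j.+1.
  set G := \sum_(j < K.+1) p j * (x - g j) ^+ 2.
  set E := p K ^+ 2 / p K.+1.
  lra.
rewrite [in X in _ <= X]big_ord_recr/=.
rewrite (big_ord_recr K (fun j => p j ^+ 2 / p j.+1))/=.
have := sq K.+1 (- p K); rewrite sqE sqrrN.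
move: partial.
set A := \sum_(j < K.+1) (g j.+1 - g j) * p j.
set B := \sum_(i < K) p i.
set B' := \sum_(i < K.+1) p i.
set D := \sum_(j < K) p j ^+ 2 / p j.+1.
set G := \sum_(j < K.+1) p j * (x - g j) ^+ 2.
set E := p K ^+ 2 / p K.+1.
lra.
Qed.

End van_trees.

Section parametric.
Context {R : realType} {d : measure_display} {Omega : measurableType d}.
Variables (P : probability Omega R) (z : nat -> Omega -> R).
Hypothesis iidz : iid_std_normal P z.

Lemma minimax_risk_ge n (Theta : set (nat -> R)) (x : \bar R) :
  (forall dl S, is_estimator dl ->
    (forall th, Theta th -> (risk P z n dl th <= S)%E) -> (x <= S)%E) ->
  (x <= minimax_risk P z n Theta)%E.
Proof.
move=> h; apply: le_ereal_inf_tmp => _ [dl edl <-].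
apply: (h dl) => // th Tth; apply: ereal_sup_ubound; by exists th.
Qed.

(** One plus the chi-square divergence of two shifted Gaussians: the quotient is a constant times
    the tilt by [2 a - b], which has mean 1. *)
Lemma has_mean_sqr_div m (a b : nat -> R) :
  has_mean P z (fun y => tiltn m a y ^+ 2 / tiltn m b y)
    (expR (\sum_(i < m) (a i - b i) ^+ 2)).
Proof.
have := has_meanZ (expR (\sum_(i < m) (a i - b i) ^+ 2))
  (has_mean_tiltn iidz m (fun i => a i + a i + - b i)).
rewrite mulr1; congr (has_mean P z _ _); apply/funext => y.
rewrite expr2 tiltnV tiltnM mulrACA tiltnM mulrA -!expRD; congr (expR _ * _).
by rewrite -!big_split/=; apply: eq_bigr => i _; ring.
Qed.

Definition single (t : R) : nat -> R := fun i => if i == 0%N then t else 0.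

Lemma Qf_single t : Qf (single t) = t ^+ 2.
Proof.
by rewrite (@Qf_finite _ 1) ?big_ord_recr ?big_ord0/= ?add0r//; case.
Qed.

(** The discrete van Trees inequality on a grid of step [h]: the numerator is the squared variation
    of [Q] across the grid, the last factor of the denominator the information of the prior and the
    noise. *)
Lemma minimax_risk_parametric n K (M h : R) (Theta : set (nat -> R)) :
  (0 < n)%N -> 0 <= h -> K.+1%:R * h <= M ->
  (forall t, 0 <= t <= M -> Theta (single t)) ->
  (((K.+1%:R * h * (2 * M - K.+1%:R * h)) ^+ 2 /
    (K.+2%:R * (2 + K.+1%:R * (expR (n%:R * h ^+ 2) - 1))))%:E
   <= minimax_risk P z n Theta)%E.
Proof.
move=> n0 h0 KhM ThetaM; apply: minimax_risk_ge => dl S edl riskS.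
set Delta := K.+1%:R * h * _; set D := 2 + _.
have D0 : 0 < D.
  rewrite /D ltr_wpDr// mulr_ge0// subr_ge0 -[leLHS]expR0 ler_expR.
  by rewrite mulr_ge0// sqr_ge0.
set s := Num.sqrt n%:R : R.
have s2 : s ^+ 2 = n%:R by rewrite sqr_sqrtr.
(* The grid ends at [M], where the derivative of the squared coordinate is largest on the ball. *)
pose t j := M - K.+1%:R * h + j%:R * h.
pose p j := tiltn 1 (fun i => s * single (t j) i).
(* This maximises [2 * lam * Delta - lam ^+ 2 * D], with value [Delta ^+ 2 / D]. *)
pose lam := Delta / D.
pose H y := K.+2%:R^-1 * (2 * lam * (\sum_(j < K.+1) (t j.+1 ^+ 2 - t j ^+ 2) * p j y)
  + (- lam ^+ 2) * (\sum_(j < K.+1) p j y + (- 2) * (\sum_(j < K) p j y)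
              + \sum_(j < K.+1) p j y ^+ 2 / p j.+1 y)).
have meanH : has_mean P z H (Delta ^+ 2 / (K.+2%:R * D)).
  have -> : Delta ^+ 2 / (K.+2%:R * D) = K.+2%:R^-1 *
    (2 * lam * (\sum_(j < K.+1) (t j.+1 ^+ 2 - t j ^+ 2) * 1)
    + (- lam ^+ 2) * (\sum_(j < K.+1) 1 + (- 2) * (\sum_(j < K) 1)
              + \sum_(j < K.+1) expR (n%:R * h ^+ 2))).
    under eq_bigr do rewrite mulr1.
    rewrite -(big_mkord xpredT (fun j => t j.+1 ^+ 2 - t j ^+ 2)) telescope_sumr//.
    have sumc (r : nat) (v : R) : \sum_(j < r) v = r%:R * v.
      by rewrite sumr_const card_ord mulr_natl.
    rewrite !sumc !mulr1.
    have -> : t K.+1 ^+ 2 - t 0%N ^+ 2 = Delta by rewrite /t /Delta; ring.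
    have -> : K.+1%:R + -2 * K%:R + K.+1%:R * expR (n%:R * h ^+ 2) = D.
      by rewrite /D -natr1; ring.
    have K2 : K.+2%:R != 0 :> R by rewrite pnatr_eq0.
    rewrite /lam; move: K.+2%:R K2 => q q0.
    by field; rewrite q0 gt_eqF.
  apply: has_meanZ; apply: has_meanD; apply: has_meanZ.
    by apply: has_mean_sum => j; apply: has_meanZ; exact: has_mean_tiltn.
  apply: has_meanD; [apply: has_meanD|].
  - by apply: has_mean_sum => j; exact: has_mean_tiltn.
  - by apply: has_meanZ; apply: has_mean_sum => j; exact: has_mean_tiltn.
  - apply: has_mean_sum => j.
    have -> : n%:R * h ^+ 2 = \sum_(i < 1) (s * single (t j) i - s * single (t j.+1) i) ^+ 2.
      by rewrite big_ord1 /single /= /t -s2 -[j.+1%:R]natr1; ring.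
    exact: has_mean_sqr_div.
apply: (bayes_lower_bound iidz (m := 1) (pi := fun=> K.+2%:R^-1)
  (th := fun j : 'I_K.+2 => single (t j)) n0 edl _ _ _ _ meanH).
- by move=> _; rewrite invr_ge0.
- by rewrite sumr_const card_ord -[LHS]mulr_natl divff ?pnatr_eq0.
- by move=> j [].
- move=> j; apply: riskS; apply: ThetaM; rewrite /t.
  have j1 : j%:R <= K.+1%:R :> R by rewrite ler_nat -ltnS.
  have jh : j%:R * h <= K.+1%:R * h by rewrite ler_wpM2r.
  have jh0 : 0 <= j%:R * h by rewrite mulr_ge0.
  by apply/andP; split; lra.
- move=> y x; rewrite -mulr_sumr /H ler_wpM2l ?invr_ge0//.
  have p0 j : 0 < p j y by exact: tiltn_gt0.
  have := discrete_van_trees K (fun j => t j ^+ 2) lam x p0.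
  rewrite mulNr mulNr => /le_trans; apply.
  by apply: ler_sum => j _; rewrite Qf_single mulrC.
Qed.

Lemma expR_sub1_le (x : R) : x < 1 -> expR x - 1 <= x / (1 - x).
Proof.
move=> x1; have x1' : 0 < 1 - x by rewrite subr_gt0.
have h : expR x * (1 - x) <= 1.
  rewrite -[leRHS](expRxMexpNx_1 x) ler_wpM2l ?expR_ge0//.
  by have := expR_ge1Dx (- x).
by rewrite ler_pdivlMr// mulrBl; lra.
Qed.

(** Here [k] is the number of grid steps and [E] stands for [expR del - 1]. Since
    [1 <= k * del ^+ 2], the boundary contributions [2] and [1] cost only a relative error of order
    [del], which the factor [1 - 10 * del] covers. *)
Lemma efficiency_ratio (k del E : R) : 0 < del <= 1 / 10 -> 1 <= k * del ^+ 2 ->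
  0 <= E -> E <= del / (1 - del) ->
  (1 - 10 * del) * ((k + 1) * (2 + k * E)) <= k ^+ 2 * del * (1 - del).
Proof.
move=> /andP[del0 del1] kdel E0 kE.
have d2 : 0 < del ^+ 2 by rewrite exprn_gt0.
have dd : del ^+ 2 <= del * (1 / 10) by rewrite expr2 ler_wpM2l// ltW.
have k0 : 0 < k by rewrite -(pmulr_lgt0 _ d2) (lt_le_trans ltr01).
have kE' : E <= del * (1 + 2 * del).
  apply: le_trans kE _; rewrite ler_pdivrMr; last lra.
  rewrite -subr_ge0 (_ : _ - _ = del * (del - 2 * del ^+ 2)); last by ring.
  by rewrite mulr_ge0 ?ltW//; lra.
have DE : 2 + k * E <= k * del * (1 + 4 * del).
  have : k * E <= k * (del * (1 + 2 * del)) by rewrite ler_wpM2l// ltW.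
  rewrite (_ : k * (_ * _) = k * del + 2 * (k * del ^+ 2)); last by ring.
  rewrite (_ : k * del * _ = k * del + 4 * (k * del ^+ 2)); last by ring.
  lra.
have k1E : k + 1 <= k * (1 + del ^+ 2) by lra.
apply: (@le_trans _ _ ((1 - 10 * del) * (k * (1 + del ^+ 2) * (k * del * (1 + 4 * del))))).
  apply: ler_wpM2l; first lra.
  apply: ler_pM => //; first lra.
  by rewrite addr_ge0// mulr_ge0// ltW.
rewrite [leLHS](_ : _ = k ^+ 2 * del * ((1 - 10 * del) * ((1 + del ^+ 2) * (1 + 4 * del)))); last by ring.
apply: ler_wpM2l; first by rewrite mulr_ge0 ?sqr_ge0// ltW.
apply: (@le_trans _ _ ((1 - 10 * del) * ((1 + del) * (1 + 4 * del)))).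
  by apply: ler_wpM2l; [lra|apply: ler_wpM2r; lra].
rewrite [leLHS](_ : _ = 1 - 5 * del - 46 * del ^+ 2 - 40 * (del * del ^+ 2)); last by ring.
have : 0 <= del * del ^+ 2 by rewrite mulr_ge0// ltW.
lra.
Qed.

Lemma minimax_risk_efficient (M : R) (Theta : set (nat -> R)) : 0 < M ->
  (forall t, 0 <= t <= M -> Theta (single t)) ->
  forall eps : R, 0 < eps -> exists N : nat, forall n : nat, (N <= n)%N ->
    (((4 * M ^+ 2 / n%:R) * (1 - eps))%:E <= minimax_risk P z n Theta)%E.
Proof.
move=> M0 ThetaM eps eps0.
(* Capping at 1 gives [del <= 1 / 10], and [10 * del <= eps] is the total loss allowed. *)
pose e := Num.min eps 1; pose del := e / 10.
have e0 : 0 < e by rewrite lt_min eps0 ltr01.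
have [e1 eeps] : e <= 1 /\ e <= eps by rewrite !ge_min !lexx orbT.
have del0 : 0 < del by rewrite /del; lra.
have del1 : del <= 1 / 10 by rewrite /del; lra.
pose K := Num.truncn (del ^- 2).
pose k : R := K.+1%:R.
have kdel : 1 <= k * del ^+ 2.
  rewrite -ler_pdivrMr ?exprn_gt0// div1r ltW// /k; exact: truncnS_gt.
have k1 : 1 <= k by rewrite ler1n.
(* From this rank on, the whole grid has length at most [M * del]. *)
exists (Num.truncn (k ^+ 2 / (M ^+ 2 * del))).+1 => n Nn.
have n0 : (0 < n)%N by exact: leq_trans Nn.
have nR0 : 0 < n%:R :> R by rewrite ltr0n.
have nk : k ^+ 2 / (M ^+ 2 * del) <= n%:R.
  apply: le_trans (_ : (Num.truncn (k ^+ 2 / (M ^+ 2 * del))).+1%:R <= _).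
    by rewrite ltW// truncnS_gt.
  by rewrite ler_nat.
(* This step makes [n * h ^+ 2 = del], so neighbouring grid points have the same divergence for
   every [n]. *)
pose h := Num.sqrt (del / n%:R).
have h2 : h ^+ 2 = del / n%:R by rewrite sqr_sqrtr// divr_ge0 ?ltW.
have h0 : 0 <= h by exact: sqrtr_ge0.
have k0 : 0 < k by lra.
have khM : k * h <= M * del.
  have Mdel0 : 0 <= M * del by rewrite mulr_ge0// ltW.
  have kh0 : 0 <= k * h by rewrite mulr_ge0// ltW.
  rewrite -(@ler_pXn2r _ 2)// (exprMn _ k h) h2 (exprMn _ M del) mulrA ler_pdivrMr//.
  move: nk; rewrite ler_pdivrMr ?mulr_gt0 ?exprn_gt0// => nk.
  rewrite [leRHS](_ : _ = n%:R * (M ^+ 2 * del) * del); last by ring.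
  by rewrite ler_wpM2r// ltW.
have Mdel : M * del <= M * (1 / 10) by rewrite ler_wpM2l// ltW.
have khM' : K.+1%:R * h <= M by rewrite -/k; lra.
apply: le_trans (minimax_risk_parametric n0 h0 khM' ThetaM).
have nh : n%:R * h ^+ 2 = del by rewrite h2 mulrCA divff ?gt_eqF// mulr1.
rewrite lee_fin nh.
rewrite -/k -[K.+2%:R]natr1 -/k.
have kE : expR del - 1 <= del / (1 - del) by apply: expR_sub1_le; lra.
have E0 : 0 <= expR del - 1 by have := expR_ge1Dx del; lra.
set E := expR del - 1 in kE E0 *.
have D0 : 0 < (k + 1) * (2 + k * E).
  by rewrite mulr_gt0// ltr_wpDr ?mulr_ge0// ltW.
have prior : (1 - eps) * ((k + 1) * (2 + k * E)) <= k ^+ 2 * del * (1 - del).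
  have del01 : 0 < del <= 1 / 10 by rewrite del0.
  apply: le_trans (efficiency_ratio del01 kdel E0 kE).
  by apply: ler_wpM2r; [exact: ltW|rewrite /del; lra].
have gap : 4 * M ^+ 2 * (1 - del) <= (2 * M - k * h) ^+ 2.
  apply: (@le_trans _ _ ((2 * M - M * del) ^+ 2)).
    rewrite -subr_ge0 (_ : _ - _ = (M * del) ^+ 2); last by ring.
    exact: sqr_ge0.
  by rewrite ler_pXn2r ?nnegrE//; lra.
rewrite ler_pdivlMr// exprMn (exprMn _ k h) h2.
rewrite -[leLHS]mulrA.
apply: (@le_trans _ _ (4 * M ^+ 2 / n%:R * (k ^+ 2 * del * (1 - del)))).
  by apply: ler_wpM2l => //; rewrite divr_ge0// ?mulr_ge0// ?sqr_ge0// ltW.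
rewrite [leLHS](_ : _ = k ^+ 2 * (del / n%:R) * (4 * M ^+ 2 * (1 - del))); last by ring.
by apply: ler_wpM2l => //; rewrite mulr_ge0 ?sqr_ge0// divr_ge0 ?ltW.
Qed.

End parametric.

(** * The sparse bound *)

Section spikes.
Context {R : realType}.
Variables (k N : nat) (pos : 'I_k -> 'I_k -> nat).
Hypothesis pos_inj : forall b r b' r', pos b r = pos b' r' -> b = b' /\ r = r'.
Hypothesis pos_lt : forall b r, (pos b r < N)%N.

(** [f] selects one offset in each block. The form as a sum over blocks lets sums over coordinates
    be exchanged with it. *)
Definition spike (c : R) (f : {ffun 'I_k -> 'I_k}) : nat -> R :=
  fun i => \sum_b (if i == pos b (f b) then c else 0).

Lemma spike_pos c f b r : spike c f (pos b r) = if f b == r then c else 0.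
Proof.
rewrite /spike (bigD1 b)//= big1 ?addr0 => [|b' b'b].
  by case: eqP => [/pos_inj[_ ->]|]; rewrite ?eqxx//; case: eqP => [->|].
by case: eqP => // /pos_inj[bb' _]; rewrite bb' eqxx in b'b.
Qed.

Lemma spike_out c f i : (forall b r, i != pos b r) -> spike c f i = 0.
Proof. by move=> ipos; rewrite /spike big1// => b _; rewrite (negbTE (ipos _ _)). Qed.

Lemma spike_supp c f i : (N <= i)%N -> spike c f i = 0.
Proof.
move=> Ni; apply: spike_out => b r; apply/eqP => ib.
by move: Ni; rewrite ib leqNgt pos_lt.
Qed.

Lemma spikeZ a c f i : a * spike c f i = spike (a * c) f i.
Proof. by rewrite mulr_sumr; apply: eq_bigr => b _; case: ifP; rewrite ?mulr0. Qed.

(** By injectivity of [pos], spikes never overlap, so each coordinate is [0] or [c]. *)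
Lemma spike_comp (F : R -> R) c f i : F 0 = 0 -> F (spike c f i) = spike (F c) f i.
Proof.
move=> F0; have [[b [r ->]]|out] := pselect (exists b r, i = pos b r).
  by rewrite !spike_pos; case: ifP.
by rewrite !spike_out// => b r; apply/eqP => ib; apply: out; exists b, r.
Qed.

Lemma sum_spike c f (G : nat -> R) :
  \sum_(i < N) spike c f i * G i = \sum_b c * G (pos b (f b)).
Proof.
under eq_bigr do rewrite mulr_suml.
rewrite exchange_big/=; apply: eq_bigr => b _.
rewrite (bigD1 (Ordinal (pos_lt b (f b))))//= eqxx big1 ?addr0// => i.
by rewrite -val_eqE/= => /negbTE ->; rewrite mul0r.
Qed.

Lemma sum_spike_spike c f f' :
  \sum_(i < N) spike c f i * spike c f' i = \sum_b (if f b == f' b then c ^+ 2 else 0).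
Proof.
rewrite sum_spike; apply: eq_bigr => b _; rewrite spike_pos eq_sym.
by case: ifP; rewrite ?mulr0.
Qed.

Lemma Qf_spike c f : Qf (spike c f) = k%:R * c ^+ 2.
Proof.
rewrite (@Qf_finite _ N); last exact: spike_supp.
under eq_bigr do rewrite expr2.
rewrite sum_spike_spike; under eq_bigr do rewrite eqxx.
by rewrite sumr_const card_ord mulr_natl.
Qed.

(** The exponential factors over blocks, so the sum over [f'] is a product of sums over offsets; in
    each block one offset matches [f] and [k - 1] do not. *)
Lemma sum_expR_overlap (v : R) (f : {ffun 'I_k -> 'I_k}) :
  \sum_(f' : {ffun 'I_k -> 'I_k}) expR (\sum_b (if f b == f' b then v else 0)) =
  (k%:R - 1 + expR v) ^+ k.
Proof.
under eq_bigr do rewrite expR_sum.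
rewrite -(bigA_distr_bigA (fun b r => expR (if f b == r then v else 0)))/=.
rewrite (eq_bigr (fun=> k%:R - 1 + expR v)) ?prodr_const ?card_ord// => b _.
rewrite (bigD1 (f b))//= eqxx addrC; congr (_ + _).
rewrite (eq_bigr (fun=> 1)) => [|r]; last by rewrite eq_sym => /negbTE ->; rewrite expR0.
rewrite sumr_const; have := cardC1 (f b); rewrite card_ord /= => e.
rewrite (eq_card (B := predC1 (f b))) => [|r]; last by rewrite !inE.
rewrite e; case: k (f b) => [[]//|k' _].
by rewrite -natr1 addrK.
Qed.

(** This is [(1 + x / k) ^+ k <= expR x] at [x = expR v - 1]. *)
Lemma overlap_le (v : R) : (0 < k)%N -> 0 <= v ->
  (k%:R - 1 + expR v) ^+ k / (k ^ k)%:R <= expR (expR v - 1).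
Proof.
move=> k0 v0; have kR : 0 < k%:R :> R by rewrite ltr0n.
rewrite natrX -expr_div_n.
have ev : 0 <= expR v - 1 by rewrite subr_ge0 -[leLHS]expR0 ler_expR.
have -> : expR (expR v - 1) = expR ((expR v - 1) / k%:R) ^+ k.
  by rewrite -expRM_natl mulrCA divff ?gt_eqF// mulr1.
apply: lerXn2r; rewrite ?nnegrE ?expR_ge0//.
  by rewrite divr_ge0//; lra.
apply: le_trans (expR_ge1Dx _).
by rewrite addrAC -addrA mulrDl divff ?gt_eqF// addrC.
Qed.

End spikes.

Section sparse.
Context {R : realType} {d : measure_display} {Omega : measurableType d}.
Variables (P : probability Omega R) (z : nat -> Omega -> R).
Hypothesis iidz : iid_std_normal P z.

Lemma has_meanM_tiltn m (a b : nat -> R) :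
  has_mean P z (fun y => tiltn m a y * tiltn m b y) (expR (\sum_(i < m) a i * b i)).
Proof.
have := has_meanZ (expR (\sum_(i < m) a i * b i))
  (has_mean_tiltn iidz m (fun i => a i + b i)).
by rewrite mulr1; congr (has_mean P z _ _); apply/funext => y; rewrite tiltnM.
Qed.

Lemma minimax_risk_sparse n k N (pos : 'I_k -> 'I_k -> nat) (c : R) (Theta : set (nat -> R)) :
  (forall b r b' r', pos b r = pos b' r' -> b = b' /\ r = r') ->
  (forall b r, (pos b r < N)%N) -> (0 < n)%N -> (0 < k)%N ->
  Theta (fun=> 0) -> (forall f, Theta (spike pos (c / Num.sqrt n%:R) f)) ->
  (((k%:R * c ^+ 2 / n%:R) ^+ 2 / (2 * (1 + expR (expR (c ^+ 2) - 1))))%:E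
    <= minimax_risk P z n Theta)%E.
Proof.
move=> pos_inj pos_lt n0 k0 T0 Tf; apply: minimax_risk_ge => dl S edl riskS.
set s := Num.sqrt n%:R : R.
have sN0 : s != 0 by rewrite gt_eqF// sqrtr_gt0 ltr0n.
set g := k%:R * c ^+ 2 / n%:R.
pose fT := {ffun 'I_k -> 'I_k}.
pose nf : R := #|{: fT}|%:R.
have nfE : nf = (k ^ k)%:R by rewrite /nf card_ffun !card_ord.
have nf0 : 0 < nf by rewrite nfE ltr0n expn_gt0 k0.
pose T (f : fT) := tiltn N (spike pos c f).
pose L y := nf^-1 * \sum_f T f y.
(* The second moment of the mixture likelihood ratio [L]. *)
pose B : R := (k%:R - 1 + expR (c ^+ 2)) ^+ k / nf.
have B0 : 0 <= B.
  apply: divr_ge0; last exact: ltW.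
  by rewrite exprn_ge0// addr_ge0 ?expR_ge0// subr_ge0 ler1n.
have BE : B <= expR (expR (c ^+ 2) - 1) by rewrite /B nfE overlap_le// sqr_ge0.
have meanL : has_mean P z L 1.
  rewrite (_ : 1 = nf^-1 * \sum_(f : fT) 1).
    by apply: has_meanZ; apply: has_mean_sum => f; exact: has_mean_tiltn.
  by rewrite sumr_const -mulr_natl mulr1 mulVf// gt_eqF.
have meanL2 : has_mean P z (fun y => L y * L y) B.
  have -> : (fun y => L y * L y) =
      (fun y => nf^-1 * nf^-1 * \sum_f \sum_f' T f y * T f' y).
    apply/funext => y; rewrite /L mulrACA; congr (_ * _).
    by rewrite mulr_suml; apply: eq_bigr => f _; rewrite mulr_sumr.
  have -> : B = nf^-1 * nf^-1 * \sum_(f : fT) \sum_(f' : fT)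
      expR (\sum_(i < N) spike pos c f i * spike pos c f' i).
    under eq_bigr => f _.
      under eq_bigr do rewrite (sum_spike_spike pos_inj pos_lt).
      rewrite sum_expR_overlap; over.
    rewrite sumr_const -[_ *+ #|_|]mulr_natl -/nf /B.
    by field; rewrite gt_eqF.
  apply: has_meanZ; apply: has_mean_sum => f; apply: has_mean_sum => f'.
  exact: has_meanM_tiltn.
(* The maximiser of [2 * lam - lam ^+ 2 * (1 + B)]. *)
pose lam := (1 + B)^-1.
pose H y := g ^+ 2 / 2 * (2 * lam * L y + (- lam ^+ 2) * (L y + L y * L y)).
have meanH : has_mean P z H (g ^+ 2 / 2 * (2 * lam * 1 + (- lam ^+ 2) * (1 + B))).
  apply: has_meanZ; apply: has_meanD; apply: has_meanZ => //.
  exact: has_meanD.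
have B1 : 0 < 1 + B by rewrite ltr_wpDr.
apply: (@le_trans _ _ (g ^+ 2 / 2 * (2 * lam * 1 + (- lam ^+ 2) * (1 + B)))%:E).
  rewrite lee_fin.
  have -> : 2 * lam * 1 + - lam ^+ 2 * (1 + B) = (1 + B)^-1.
    by rewrite /lam; field; rewrite gt_eqF.
  rewrite invfM mulrA ler_wpM2l//; first by rewrite divr_ge0// sqr_ge0.
  by rewrite lef_pV2 ?posrE// ?lerD2l// (lt_le_trans B1)// lerD2l.
(* [None] is the zero signal and gets half the mass; the spike signals share the other half
   equally. *)
pose pi (o : option fT) : R := if o is Some _ then (2 * nf)^-1 else 2^-1.
pose th (o : option fT) : nat -> R :=
  if o is Some f then spike pos (c / s) f else fun=> 0.
have big_opt (F : option fT -> R) : \sum_o F o = F None + \sum_f F (Some f).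
  rewrite (bigD1 None)//=; congr (_ + _).
  rewrite [LHS](reindex_omap Some id)/=; last by case.
  by apply: eq_bigl => f; rewrite eqxx.
apply: (bayes_lower_bound iidz (m := N) (pi := pi) (th := th) n0 edl _ _ _ _ meanH).
- by case=> [f|]; rewrite /pi invr_ge0// mulr_ge0// ltW.
- rewrite big_opt /pi /= sumr_const -[_ *+ #|_|]mulr_natl -/nf.
  by field; rewrite gt_eqF.
- case=> [f|] j Nj //=; exact: (spike_supp pos_lt).
- by case=> [f|]; apply: riskS => //; exact: Tf.
move=> y x; rewrite big_opt /=.
have Q0 : Qf (fun=> 0 : R) = 0 by rewrite (@Qf_finite _ 0) ?big_ord0.
have s2 : s ^+ 2 = n%:R by rewrite sqr_sqrtr.
have Qs f : Qf (spike pos (c / s) f) = g.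
  by rewrite (Qf_spike pos_inj pos_lt) expr_div_n s2 mulrA.
rewrite Q0 subr0.
have -> : tiltn N (fun j => s * 0) y = 1.
  by rewrite /tiltn big1// => i _; rewrite /tilt mulr0 mul0r expr0n/= mul0r subr0 expR0.
rewrite mulr1.
have -> : \sum_(f : fT) (2 * nf)^-1 * ((x - Qf (spike pos (c / s) f)) ^+ 2 *
    tiltn N (fun j => s * spike pos (c / s) f j) y) = 2^-1 * ((x - g) ^+ 2 * L y).
  rewrite /L !mulrA mulr_sumr; apply: eq_bigr => f _.
  have -> : tiltn N (fun j => s * spike pos (c / s) f j) y = T f y.
    rewrite /T; congr (tiltn N _ y).
    by apply/funext => j; rewrite spikeZ mulrCA divff ?mulr1.
  by rewrite Qs; field; rewrite gt_eqF.
have L0 : 0 <= L y.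
  apply: mulr_ge0; first by rewrite invr_ge0 ltW.
  by apply: sumr_ge0 => f _; rewrite ltW// tiltn_gt0.
rewrite /H -subr_ge0.
(* Completing one square under each hypothesis: the cross terms in [x] cancel, leaving exactly
   [H]. *)
rewrite (_ : _ - _ = 2^-1 * ((x - lam * g * L y) ^+ 2 + L y * (x - g + lam * g) ^+ 2)); last by field.
apply: mulr_ge0 => //; apply: addr_ge0; first exact: sqr_ge0.
by apply: mulr_ge0 => //; exact: sqr_ge0.
Qed.

End sparse.

(** * Signals in the balls *)

Section balls.
Context {R : realType}.
Variables (p q al M : R).
Hypotheses (p0 : 0 < p) (q0 : 0 < q) (M0 : 0 < M).

Let pn0 : p != 0. Proof. by rewrite gt_eqF. Qed.
Let qn0 : q != 0. Proof. by rewrite gt_eqF. Qed.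

Lemma eseries_finite m (u : nat -> \bar R) : (forall i, (m <= i)%N -> u i = 0%E) ->
  (\sum_(0 <= i <oo) u i = \sum_(i < m) u i)%E.
Proof.
move=> um; rewrite -(big_mkord xpredT u).
apply: lim_near_cst => //.
near=> k.
have mk : (m <= k)%N by near: k; exact: nbhs_infty_ge.
rewrite (big_cat_nat (leq0n m) mk)//= -[RHS]adde0; congr (_ + _)%E.
rewrite big_nat_cond big1// => i /andP[/andP[mi _] _].
by rewrite um.
Unshelve. all: by end_near. Qed.

Lemma powRK (r x : R) : r != 0 -> 0 <= x -> (x `^ r) `^ r^-1 = x.
Proof. by move=> r0 x0; rewrite -powRrM divff// powRr1. Qed.

Lemma le_powRV (r x y : R) : 0 < r -> 0 <= x -> 0 <= y -> x <= y `^ r -> x `^ r^-1 <= y.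
Proof.
move=> r0 x0 y0 xy; rewrite -[leRHS](@powRK r)// ?gt_eqF//.
by apply: ge0_ler_powR => //; rewrite ?nnegrE ?powR_ge0// invr_ge0 ltW.
Qed.

Lemma Lp_ball_finite N (th : nat -> R) : (forall i, (N <= i)%N -> th i = 0) ->
  \sum_(i < N) i.+1%:R `^ (p * sidx p al) * `|th i| `^ p <= M `^ p ->
  Lp_ball p al M th.
Proof.
move=> thN sumM; rewrite /Lp_ball /= (@eseries_finite N); last first.
  by move=> i Ni; rewrite thN// normr0 powR0// mulr0.
rewrite sumEFin poweR_EFin lee_fin; apply: le_powRV => //; last exact: ltW.
by apply: sumr_ge0 => i _; rewrite mulr_ge0// powR_ge0.
Qed.

(** With one nonzero level the outer sum has a single term, and the power [q^-1] undoes the power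
    [q]. *)
Lemma Besov_ball_level j (th : nat -> R) :
  (forall j' (l : 'I_(2 ^ j')), j' != j -> th (2 ^ j' + l).-1 = 0) ->
  2 `^ (j%:R * sidx p al) * besov_level p th j <= M -> Besov_ball p q al M th.
Proof.
move=> thj levelM; have level0 j' : j' != j -> besov_level p th j' = 0.
  move=> j'j; rewrite /besov_level big1 ?powR0 ?invr_eq0// => l _.
  by rewrite thj// normr0 powR0.
rewrite /Besov_ball /= (@eseries_finite j.+1) => [|i ji]; last first.
  by rewrite level0 ?gtn_eqF// mulr0 powR0.
rewrite big_ord_recr big1/= => [|i _]; last first.
  by rewrite level0 ?ltn_eqF// mulr0 powR0.
by rewrite lee_fin add0r powRK// mulr_ge0// ?/besov_level ?powR_ge0.
Qed.

Lemma single_Lp_ball t : 0 <= t <= M -> Lp_ball p al M (single t).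
Proof.
move=> /andP[t0 tM]; apply: (@Lp_ball_finite 1) => [[]//|].
rewrite big_ord1 /single/= powR1 mul1r ger0_norm//.
by apply: ge0_ler_powR; rewrite ?nnegrE// ltW.
Qed.

Lemma single_Besov_ball t : 0 <= t <= M -> Besov_ball p q al M (single t).
Proof.
(* Coordinate [0] is the only entry of level 0, whose weight is 1. *)
move=> /andP[t0 tM]; apply: (@Besov_ball_level 0).
  move=> [//|j] l _; rewrite /single ifF//; apply/negbTE.
  by rewrite -lt0n -subn1 subn_gt0 (leq_trans _ (leq_addr _ _))// expnS leq_pmulr// expn_gt0.
rewrite mul0r powRr0 mul1r /besov_level.
by rewrite big_ord1 /single/= ger0_norm// powRK.
Qed.

Variable m : nat.

(* Position [b * 2 ^ m + r] inside the Besov level [j = 2 m]. *)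
Definition level_pos (b r : 'I_(2 ^ m)) : nat := (2 ^ m.*2 + (b * 2 ^ m + r)).-1.

Lemma block_lt (b r : 'I_(2 ^ m)) : (b * 2 ^ m + r < 2 ^ m.*2)%N.
Proof.
rewrite -addnn expnD (leq_trans (_ : _ < b.+1 * 2 ^ m)%N)//.
  by rewrite mulSn addnC ltn_add2r.
by rewrite leq_mul2r ltn_ord orbT.
Qed.

Lemma level_posE (b r : 'I_(2 ^ m)) : (level_pos b r).+1 = (2 ^ m.*2 + (b * 2 ^ m + r))%N.
Proof. by rewrite /level_pos prednK// addn_gt0 expn_gt0. Qed.

Lemma level_pos_inj b r b' r' : level_pos b r = level_pos b' r' -> b = b' /\ r = r'.
Proof.
move=> /(congr1 succn); rewrite !level_posE => /addnI e.
have k0 : (0 < 2 ^ m)%N by rewrite expn_gt0.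
split; apply: val_inj => /=.
  by have := congr1 (fun x => x %/ 2 ^ m)%N e; rewrite !divnMDl// !divn_small// !addn0.
by have := congr1 (fun x => x %% 2 ^ m)%N e; rewrite !modnMDl !modn_small.
Qed.

Lemma level_pos_lt b r : (level_pos b r < 2 ^ m.*2.+1)%N.
Proof. by rewrite level_posE expnS mul2n -[(2 ^ _).*2%N]addnn leq_add2l ltnW// block_lt. Qed.

(** Level [j] occupies the dyadic range from [2 ^ j] up to but excluding [2 ^ j.+1], and these
    ranges are disjoint. *)
Lemma level_unique j j' l l' : (l < 2 ^ j)%N -> (l' < 2 ^ j')%N ->
  (2 ^ j + l = 2 ^ j' + l')%N -> j = j'.
Proof.
wlog jj' : j j' l l' / (j < j')%N.
  move=> h lj lj' e; case: (ltngtP j j') => // jj'; first exact: h e.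
  exact/esym/(h _ _ _ _ jj' lj' lj (esym e)).
move=> lj lj' e; have : (2 ^ j.+1 <= 2 ^ j + l)%N.
  by rewrite e (leq_trans _ (leq_addr _ _))// leq_exp2l.
by rewrite expnS mul2n -addnn leq_add2l leqNgt lj.
Qed.

Let k : R := (2 ^ m)%:R.

Variable a : R.
Hypothesis a0 : 0 <= a.
Hypothesis s0 : 0 < sidx p al.
(** There are [k] spikes of height [a], at one-based indices below [2 * k ^+ 2 = 2 ^ m.*2.+1];
    bounding all weights by this endpoint gives one condition for both balls. *)
Hypothesis aM : (2 * k ^+ 2) `^ (p * sidx p al) * (k * a `^ p) <= M `^ p.

Let k0 : 0 < k. Proof. by rewrite ltr0n expn_gt0. Qed.

Let powR_spike f i : `|spike level_pos a f i| `^ p = spike level_pos (a `^ p) f i.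
Proof.
have F0 : `|0 : R| `^ p = 0 by rewrite normr0 powR0.
by rewrite (spike_comp level_pos_inj (F := fun x : R => `|x| `^ p) a f i F0) ger0_norm.
Qed.

Lemma spike_Lp_ball f : Lp_ball p al M (spike level_pos a f).
Proof.
apply: (@Lp_ball_finite (2 ^ m.*2.+1)); first exact: (spike_supp level_pos_lt).
apply: le_trans aM.
have -> : k * a `^ p = \sum_(i < 2 ^ m.*2.+1) spike level_pos (a `^ p) f i * 1.
  rewrite (sum_spike level_pos_lt _ f (fun=> 1)) sumr_const card_ord.
  by rewrite mulr1 mulr_natl.
rewrite mulr_sumr; apply: ler_sum => i _; rewrite powR_spike mulr1.
apply: ler_wpM2r; first by rewrite -powR_spike powR_ge0.
apply: ge0_ler_powR; rewrite ?nnegrE//.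
- by rewrite mulr_ge0// ltW.
- by rewrite mulr_ge0// sqr_ge0.
- by rewrite /k -natrX -natrM ler_nat -expnM muln2 -expnS.
Qed.

Lemma spike_Besov_ball f : Besov_ball p q al M (spike level_pos a f).
Proof.
apply: (@Besov_ball_level m.*2).
  move=> j' l j'm; apply: spike_out => b r; apply: contra j'm => /eqP e.
  apply/eqP; apply: (level_unique (ltn_ord l) (block_lt b r)).
  by rewrite -level_posE -e prednK// addn_gt0 expn_gt0.
have levelE : \sum_(l < 2 ^ m.*2) `|spike level_pos a f (2 ^ m.*2 + l).-1| `^ p = k * a `^ p.
  under eq_bigr do rewrite powR_spike.
  rewrite exchange_big/= (eq_bigr (fun=> a `^ p)) ?sumr_const ?card_ord ?mulr_natl// => b _.
  rewrite (bigD1 (Ordinal (block_lt b (f b))))//= eqxx big1 ?addr0// => l.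
  rewrite -val_eqE/= => lb; case: eqP => // /(congr1 succn).
  rewrite level_posE prednK ?addn_gt0 ?expn_gt0// => /addnI e.
  by rewrite e eqxx in lb.
rewrite /besov_level levelE -[leLHS](@powRK p)//; last by rewrite mulr_ge0 ?powR_ge0.
apply: le_powRV => //; [by rewrite powR_ge0|exact: ltW|].
apply: le_trans aM.
have ka0 : 0 <= k * a `^ p by rewrite mulr_ge0 ?powR_ge0// ltW.
rewrite powRM ?powR_ge0// -!powRrM mulVf// powRr1//.
apply: ler_wpM2r => //.
have -> : 2 `^ (m.*2%:R * sidx p al * p) = (k ^+ 2) `^ (p * sidx p al) :> R.
  rewrite -mulrA powRrM powR_mulrn// /k natrX -exprM muln2.
  by rewrite [p * _]mulrC.
apply: ge0_ler_powR; rewrite ?nnegrE.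
- by rewrite mulr_ge0// ltW.
- exact: sqr_ge0.
- by rewrite mulr_ge0// sqr_ge0.
- by have := sqr_ge0 k; lra.
Qed.

End balls.

(** * Choice of the number of blocks and the final assembly *)

Lemma pow2_bracket (R : realType) (X : R) : 1 <= X ->
  exists m, (2 ^ m)%:R <= X /\ X <= 2 * (2 ^ m)%:R.
Proof.
move=> X1; pose t := Num.truncn X.
have t0 : (0 < t)%N by rewrite truncn_gt0.
have /andP[tlo thi] := trunc_log_bounds (ltnSn 1) t0.
exists (trunc_log 2 t); split.
  apply: (@le_trans _ _ t%:R); first by rewrite ler_nat.
  by rewrite truncn_le; lra.
apply: (@le_trans _ _ t.+1%:R); first by rewrite ltW// truncnS_gt.
by rewrite -natrM -expnS ler_nat.
Qed.

Theorem theorem4 (R : realType) (p q M al : R) (Theta : set (nat -> R))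
  (d : measure_display) (Omega : measurableType d)
  (P : probability Omega R) (z : nat -> Omega -> R) :
  0 < p < 2 -> 0 < q -> 0 < M -> 0 < al -> 0 < sidx p al ->
  (Theta = Besov_ball p q al M \/ Theta = Lp_ball p al M) ->
  iid_std_normal P z ->
  ((2 * p)^-1 < al ->
     forall eps : R, 0 < eps -> exists N : nat, forall n : nat, (N <= n)%N ->
       (((4 * M ^+ 2 / n%:R) * (1 - eps))%:E <= minimax_risk P z n Theta)%E) /\
  (al <= (2 * p)^-1 ->
     exists C : R, 0 < C /\ exists N : nat, forall n : nat, (N <= n)%N ->
       ((C * n%:R `^ (- (2 - p / (1 + 2 * p * sidx p al))))%:E
         <= minimax_risk P z n Theta)%E).
Proof.
move=> /andP[p0 _] q0 M0 al0 s0 ThetaE iidz; split=> _.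
  apply: (minimax_risk_efficient iidz) => // t tM.
  by case: ThetaE => ->; [exact: single_Besov_ball|exact: single_Lp_ball].
set s := sidx p al in s0 *.
have powD (x u v : R) : 0 < x -> x `^ (u + v) = x `^ u * x `^ v.
  by move=> x0; rewrite powRD// [x == 0]gt_eqF// implybT.
(* The factor [2 ^ (- s)] absorbs the 2 in [2 * k ^+ 2], so ball membership reduces to
   [k ^ (1 + 2 p s) <= n ^ (p / 2)]. *)
pose c := M * 2 `^ (- s).
have c0 : 0 < c by rewrite mulr_gt0// powR_gt0.
pose D := 2 * (1 + expR (expR (c ^+ 2) - 1)).
have D0 : 0 < D by rewrite mulr_gt0// addr_gt0// expR_gt0.
have ps0 : 0 < 1 + 2 * p * s by rewrite addr_gt0// !mulr_gt0.
(* The 4 comes from squaring [k >= X / 2], the loss in rounding [X] down to a power of two. *)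
exists (c ^+ 4 / (4 * D)); split.
  by rewrite divr_gt0 ?exprn_gt0// mulr_gt0.
exists 1%N => n n0.
have nR1 : 1 <= n%:R :> R by rewrite ler1n.
have nR0 : 0 < n%:R :> R by rewrite ltr0n.
(* The real number of blocks at which the ball constraint is an equality; [X ^+ 2 / n ^+ 2] is then
   the claimed rate. *)
pose X : R := n%:R `^ (p / (2 * (1 + 2 * p * s))).
have X1 : 1 <= X.
  by rewrite -[leLHS](powRr0 n%:R) ler_powR// divr_ge0 ?mulr_ge0 ?ltW.
have [m [kX Xk]] := pow2_bracket X1.
set k : R := (2 ^ m)%:R in kX Xk.
have k0 : 0 < k by rewrite ltr0n expn_gt0.
have X0 : 0 < X by exact: lt_le_trans ltr01 X1.
pose a := c / Num.sqrt n%:R.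
have a0 : 0 <= a by rewrite divr_ge0 ?sqrtr_ge0// ltW.
have aM : (2 * k ^+ 2) `^ (p * s) * (k * a `^ p) <= M `^ p.
  have -> : (2 * k ^+ 2) `^ (p * s) * (k * a `^ p) =
      k `^ (1 + 2 * p * s) * (2 `^ (p * s) * a `^ p).
    rewrite powRM ?sqr_ge0// -[k ^+ 2]powR_mulrn ?ltW// -powRrM powD//.
    rewrite powRr1 ?ltW//.
    rewrite (_ : 2%:R * (p * s) = 2 * p * s); last by ring.
    by ring.
  have -> : M `^ p = X `^ (1 + 2 * p * s) * (2 `^ (p * s) * a `^ p).
    rewrite /a /c -powR12_sqrt// powRM ?powR_ge0 ?invr_ge0//; last by rewrite mulr_ge0 ?powR_ge0 ?ltW.
    rewrite powRM ?powR_ge0 ?ltW// -powRN -!powRrM.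
    rewrite (_ : p / _ * _ = p / 2); last by field; rewrite gt_eqF.
    rewrite (_ : n%:R `^ (p / 2) * _ = M `^ p * (2 `^ (p * s) * 2 `^ (- s * p)) *
      (n%:R `^ (p / 2) * n%:R `^ (- 2^-1 * p))); last by ring.
    rewrite -!powD//.
    by rewrite mulNr [s * p]mulrC subrr mulNr [2^-1 * p]mulrC subrr !powRr0 !mulr1.
  apply: ler_wpM2r; first by rewrite mulr_ge0 ?powR_ge0.
  by apply: ge0_ler_powR; rewrite ?nnegrE// ltW.
have Tspike f : Theta (spike (@level_pos m) a f).
  by case: ThetaE => ->; [apply: spike_Besov_ball|apply: spike_Lp_ball].
have T0 : Theta (fun=> 0).
  have -> : (fun=> 0) = single 0 :> (nat -> R) by apply/funext => -[].
  have M00 : 0 <= (0 : R) <= M by rewrite lexx ltW.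
  by case: ThetaE => ->; [exact: single_Besov_ball|exact: single_Lp_ball].
have := minimax_risk_sparse iidz (@level_pos_inj m) (@level_pos_lt m) n0 _ T0 Tspike.
rewrite expn_gt0 => /(_ isT); apply: le_trans.
rewrite lee_fin -/k -/D.
have -> : n%:R `^ (- (2 - p / (1 + 2 * p * s))) = X ^+ 2 / n%:R ^+ 2.
  rewrite -!powR_mulrn ?ltW// -powRrM -powRN -powD//.
  by congr (_ `^ _); field; rewrite gt_eqF.
rewrite (_ : _ * _ = (X / 2 * c ^+ 2 / n%:R) ^+ 2 / D); last first.
  by field; rewrite !gt_eqF.
apply: ler_wpM2r; first by rewrite invr_ge0 ltW.
apply: lerXn2r; rewrite ?nnegrE.
- by apply: divr_ge0 => //; rewrite mulr_ge0 ?sqr_ge0// divr_ge0// ltW.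
- by apply: divr_ge0 => //; rewrite mulr_ge0 ?sqr_ge0// ltW.
- apply: ler_wpM2r; first by rewrite invr_ge0 ltW.
  by apply: ler_wpM2r; [exact: sqr_ge0|lra].
Qed.
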